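(* Let $G$ be a finite abelian group of order $n$ and let $\{A_1,A_2\}$ be a partition of $G$ into two nonempty sets with $|A_1|=k$. Then $\{A_1,A_2\}$ is an $(n,2;k,n-k;\ell)$-RWEDF (for some $\ell$) if and only if there is $\lambda$ such that $A_1$ is an $(n,k,\lambda)$ difference set in $G$ and $A_2$ is an $(n,n-k,n-2k+\lambda)$ difference set in $G$. For such an RWEDF, $\ell=\frac{n}{n-1}$; in particular $\ell\in\mathbb{Q}\setminus\mathbb{Z}$.
   Context: $G$ is written additively, $G^*=G\setminus\{0\}$. For pairwise disjoint nonempty subsets $A_1,\dots,A_m$ of $G$ and $\delta\in G^*$, let $N_i(\delta)=|\{(a_i,a_j): a_i\in A_i,\ a_j\in A_j \text{ for some } j\neq i,\ a_i-a_j=\delta\}|$. An $(n,m;k_1,\dots,k_m;\ell)$-RWEDF is a collection of pairwise disjoint subsets with $|A_i|=k_i$ such that $\sum_i \frac{1}{k_i}N_i(\delta)=\ell$ for all $\delta\in G^*$. An $(n,k,\lambda)$ difference set in $G$ is a $k$-subset $D$ such that every element of $G^*$ can be written as $d_1-d_2$ with $d_1,d_2\in D$ in exactly $\lambda$ ways.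
   Formalization: The final claim that ℓ is not an integer is stated only for n ≠ 2, since for n = 2 (G = Z/2, A_1 = {0}, A_2 = {1}) one has ℓ = n/(n-1) = 2; everything else is stated for all n. *)

(* Defs.v *)
From HB Require Import structures.
From mathcomp Require Import all_boot all_order all_algebra.

Set Implicit Arguments.
Unset Strict Implicit.
Unset Printing Implicit Defensive.

Import GRing.Theory.
Local Open Scope ring_scope.

Definition cross_diff_count (G : finZmodType) (m : nat) (A : m.-tuple {set G})
    (i : 'I_m) (delta : G) : nat :=
  #|[set p : G * G | [&& p.1 \in tnth A i,
                         [exists j : 'I_m, (j != i) && (p.2 \in tnth A j)]
                       & p.1 - p.2 == delta]]|.

Definition is_RWEDF (G : finZmodType) (n m : nat) (k : m.-tuple nat) (l : rat)
    (A : m.-tuple {set G}) : Prop :=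
  [/\ #|G| = n,
      forall i : 'I_m, tnth A i != set0,
      forall i j : 'I_m, i != j -> [disjoint tnth A i & tnth A j],
      forall i : 'I_m, #|tnth A i| = tnth k i
    & forall delta : G, delta != 0 ->
        \sum_(i < m) (tnth k i)%:R^-1 * (cross_diff_count A i delta)%:R = l].

(* [lambda] is an [int] so that parameters such as n - 2k + lambda are computed
   without truncated subtraction. *)
Definition is_difference_set (G : finZmodType) (n k : nat) (lambda : int)
    (D : {set G}) : Prop :=
  [/\ #|G| = n, #|D| = k
    & forall delta : G, delta != 0 ->
        #|[set p : G * G | [&& p.1 \in D, p.2 \in D & p.1 - p.2 == delta]]|%:Z
          = lambda].

(* Main.v *)
Require Import Defs.
From mathcomp Require Import all_boot all_order all_algebra.
From mathcomp Require Import zify ring.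

Import Order.TTheory GRing.Theory Num.Theory.
Local Open Scope ring_scope.

(** Write N(A, B; d) for the number of pairs in A * B with difference d. As A1
    and A2 partition G, N(A1, A1; d) + N(A1, A2; d) = |A1| (fix the first
    coordinate) and N(A1, A1; d) + N(A2, A1; d) = |A1| (fix the second one),
    so N(A1, A2; d) = N(A2, A1; d) = k - N(A1, A1; d), and the weighted sum is
    n (k - N(A1, A1; d)) / (k (n - k)): it is constant in d iff N(A1, A1; d) is.
    Counting all pairs of A1 * A2 gives (n - 1) (k - lambda) = k (n - k), hence
    l = n / (n - 1). *)

Section DiffCount.

Set Implicit Arguments.

Variable G : finZmodType.
Implicit Types (A B C : {set G}) (d : G).

(** For [A = B = D] this is convertible to the count in [is_difference_set], so it can be folded
    there directly. *)
Definition diff_count A B d : nat :=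
  #|[set p : G * G | [&& p.1 \in A, p.2 \in B & p.1 - p.2 == d]]|.

(** The first coordinate [x] of a pair determines the second as [x - d]. *)
Lemma diff_countEl A B d : diff_count A B d = #|[set x in A | x - d \in B]|.
Proof.
have injf : injective (fun x : G => (x, x - d)) by move=> x y [].
rewrite /diff_count -(card_imset _ injf); apply: eq_card => -[x y].
rewrite !inE /=; apply/and3P/imsetP => [[Ax By /eqP <-]|[z]].
  by exists x; rewrite ?inE ?Ax subKr.
by rewrite inE => /andP[Az Bz] [-> ->]; rewrite subKr.
Qed.

Lemma diff_countC A B d : diff_count A B d = diff_count B A (- d).
Proof.
have injf : injective (fun p : G * G => (p.2, p.1)) by move=> [? ?] [? ?] [-> ->].
rewrite /diff_count -(card_imset _ injf); apply: eq_card => -[x y].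
rewrite !inE /=; apply/imsetP/and3P => [[[z t]]|[Bx Ay /eqP xyd]].
  by rewrite inE /= => /and3P[Az Bt /eqP <-] [-> ->]; rewrite opprB.
by exists (y, x); rewrite // inE /= Ay Bx -opprB xyd opprK eqxx.
Qed.

Lemma diff_count0 A B : [disjoint A & B] -> diff_count A B 0 = 0%N.
Proof.
move=> AB0; rewrite diff_countEl; apply/eqP; rewrite cards_eq0; apply/eqP.
apply/setP=> x; rewrite !inE subr0.
by apply/negP => /andP[/(disjointFr AB0) ->].
Qed.

Lemma sum_diff_count A B : (\sum_d diff_count A B d = #|A| * #|B|)%N.
Proof.
rewrite -cardsX -sum1_card (partition_big (fun p => p.1 - p.2) predT) //=.
apply: eq_bigr => d _; rewrite /diff_count -sum1_card; apply: eq_bigl => p.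
by rewrite !inE andbA.
Qed.

(** For each [x] in [A], the element [x - d] lies in exactly one of [B] and [C]. *)
Lemma diff_count_splitr A B C d : [disjoint B & C] -> B :|: C = [set: G] ->
  (diff_count A B d + diff_count A C d = #|A|)%N.
Proof.
move=> BC0 BCT; rewrite !diff_countEl -(cardsID [set x | x - d \in B] A).
have xBC x : (x \in C) = (x \notin B).
  have := in_setT x; rewrite -BCT inE.
  by case: (boolP (x \in B)) => [/(disjointFr BC0)|].
by congr (_ + _)%N; apply: eq_card => x; rewrite !inE // xBC andbC.
Qed.

Lemma diff_count_splitl A B C d : [disjoint B & C] -> B :|: C = [set: G] ->
  (diff_count B A d + diff_count C A d = #|A|)%N.
Proof. by rewrite 2!(diff_countC _ A); apply: diff_count_splitr. Qed.

End DiffCount.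

(** With two sets, the only index [j] different from [i] is the other one. *)
Lemma cross_diff_count_pair (G : finZmodType) (A1 A2 : {set G}) (d : G) :
  (cross_diff_count [tuple A1; A2] ord0 d = diff_count A1 A2 d) *
  (cross_diff_count [tuple A1; A2] (lift ord0 ord0) d = diff_count A2 A1 d).
Proof.
split; apply: eq_card => p; rewrite !inE; congr [&& _, _ & _].
  apply/existsP/idP => [[j] /andP[]|A2p]; last by exists (lift ord0 ord0).
  by case: j => -[|[|//]] ltj //=; rewrite (tnth_nth set0).
apply/existsP/idP => [[j] /andP[]|A1p]; last by exists ord0.
by case: j => -[|[|//]] ltj //=; rewrite (tnth_nth set0).
Qed.

(** If the quotient were an integer [z], then [n = z * (n - 1)]. But [z <= 1] gives at most [n - 1],
    and [z >= 2] gives at least [2 * n - 2], which exceeds [n] as soon as [n > 2]. *)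
Lemma natr_div_pred_nint (n : nat) : (2 < n)%N ->
  (n%:R / (n%:R - 1) : rat) \isn't a Num.int.
Proof.
move=> n2; apply/negP => /intrP[z Ez].
have n1 : (n%:R - 1 : rat) != 0 by rewrite subr_eq0 pnatr_eq1; lia.
have /eqP : n%:R = z%:~R * (n%:R - 1) :> rat by rewrite -Ez divfK.
rewrite -[n%:R]/((n%:Z)%:~R) -[1]/(1%:~R) -intrB -intrM eqr_int => /eqP.
by case: (leP z 1) => [z1|z2]; nia.
Qed.

Theorem mainTheorem6 (G : finZmodType) (n k : nat) (A1 A2 : {set G})
    (cardG : #|G| = n) (A1_neq0 : A1 != set0) (A2_neq0 : A2 != set0)
    (disjA : [disjoint A1 & A2]) (coverA : A1 :|: A2 = [set: G])
    (cardA1 : #|A1| = k) :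
  ((exists l : rat,
      is_RWEDF n [tuple k; (n - k)%N] l [tuple A1; A2])
   <->
   (exists lambda : int,
      is_difference_set n k lambda A1 /\
      is_difference_set n (n - k)%N (n%:Z - 2 * k%:Z + lambda) A2))
  /\
  (forall l : rat,
     is_RWEDF n [tuple k; (n - k)%N] l [tuple A1; A2] ->
     l = n%:R / (n%:R - 1) /\ (n <> 2%N -> l \isn't a Num.int)).
Proof.
have cardD : (#|A1| + #|A2| = n)%N.
  by rewrite -cardG -cardsT -coverA cardsU (disjoint_setI0 disjA) cards0 subn0.
have k_gt0 : (0 < k)%N by rewrite -cardA1 card_gt0.
have cardA2_gt0 : (0 < #|A2|)%N by rewrite card_gt0.
have cardA2 : #|A2| = (n - k)%N by lia.
have ltkn : (k < n)%N by lia.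
have N12 d : (diff_count A1 A1 d + diff_count A1 A2 d = k)%N.
  by rewrite diff_count_splitr.
have N21 d : diff_count A2 A1 d = diff_count A1 A2 d.
  by have := N12 d; have := diff_count_splitl A1 d disjA coverA; lia.
have N22 d : (diff_count A1 A2 d + diff_count A2 A2 d = n - k)%N.
  by rewrite diff_count_splitl.
have k0 : (k%:R : rat) != 0 by rewrite pnatr_eq0; lia.
have nk0 : (n%:R - k%:R : rat) != 0.
  by rewrite -natrB ?pnatr_eq0; lia.
have n0 : (n%:R : rat) != 0 by rewrite pnatr_eq0; lia.
have n10 : (n%:R - 1 : rat) != 0 by rewrite subr_eq0 pnatr_eq1; lia.
(* Both counts agree by [N21], and 1/k + 1/(n - k) = n / (k (n - k)). *)
have RW d : \sum_(i < 2) (tnth [tuple k; (n - k)%N] i)%:R^-1 *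
      (cross_diff_count [tuple A1; A2] i d)%:R
    = n%:R / (k%:R * (n%:R - k%:R)) * (diff_count A1 A2 d)%:R :> rat.
  rewrite !big_ord_recl big_ord0 !cross_diff_count_pair N21 !(tnth_nth 0%N) /=.
  by rewrite natrB ?(ltnW ltkn) //; field; rewrite k0 nk0.
(* A reference difference at which the constant values are read off; disjointness makes [x - y]
   nonzero. *)
have [d0 d0_neq0] : exists d : G, d != 0.
  have [x A1x] := set0Pn _ A1_neq0; have [y A2y] := set0Pn _ A2_neq0.
  exists (x - y); rewrite subr_eq0; apply: contraTneq A1x => ->.
  by rewrite (disjointFl disjA).
split; first split.
- case=> l [_ _ _ _ ldiff].
  have N12_const d : d != 0 -> diff_count A1 A2 d = diff_count A1 A2 d0.
    move=> d_neq0; have := ldiff _ d_neq0; rewrite -(ldiff _ d0_neq0) !RW.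
    have c0 : n%:R / (k%:R * (n%:R - k%:R)) != 0 :> rat.
      by rewrite mulf_neq0 ?invr_neq0 ?mulf_neq0.
    by move/(mulfI c0)/eqP; rewrite eqr_nat => /eqP.
  (* For [A2], [N22] and [N12] give (n - k) - (k - lambda) = n - 2k + lambda. *)
  exists (diff_count A1 A1 d0)%:Z; split; split=> // d d_neq0;
    rewrite -/(diff_count _ _ d);
    have := N12_const d d_neq0; have := N12 d; have := N12 d0; have := N22 d; lia.
- case=> lam [[_ _ N11] _].
  exists (n%:R / (k%:R * (n%:R - k%:R)) * (diff_count A1 A2 d0)%:R); split=> //.
  + by case=> -[|[|//]] ltj; rewrite (tnth_nth set0).
  + case=> -[|[|//]] lti; case=> -[|[|//]] ltj //= _; rewrite !(tnth_nth set0) //=.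
    by rewrite disjoint_sym.
  + by case=> -[|[|//]] ltj; rewrite (tnth_nth set0) (tnth_nth 0%N).
  + move=> d d_neq0; rewrite RW; congr (_ * _%:R).
    have := N11 _ d_neq0; have := N11 _ d0_neq0; rewrite -!/(diff_count _ _ _).
    by have := N12 d; have := N12 d0; lia.
- move=> l [_ _ _ _ ldiff].
  have suml : l * (n%:R - 1) = n%:R.
    (* All pairs of [A1] and [A2] are counted here, since disjointness makes the term at [0]
       vanish. *)
    have sum12 : \sum_(d : G | d != 0) (diff_count A1 A2 d)%:R
        = k%:R * (n%:R - k%:R) :> rat.
      rewrite -natr_sum -natrB ?(ltnW ltkn) // -natrM -cardA2 -cardA1.
      rewrite -sum_diff_count [in RHS](bigD1 0) //=.
      by rewrite diff_count0.
    (* Summing [RW] over nonzero [d] cancels the factor k (n - k). *)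
    have : \sum_(d : G | d != 0) l = n%:R.
      rewrite -(eq_bigr _ (fun d dn0 => etrans (esym (RW d)) (ldiff d dn0))).
      by rewrite -mulr_sumr sum12 divfK // mulf_neq0.
    rewrite sumr_const cardC1 cardG -(mulr_natr l) -subn1 natrB //.
    by lia.
  have -> : l = n%:R / (n%:R - 1) by rewrite -[LHS](mulfK n10) suml.
  (* Two nonempty parts force [n >= 2]; at [n = 2] the quotient is the integer 2, hence the
     exclusion. *)
  by split=> // n2; apply: natr_div_pred_nint; lia.
Qed.
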